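(* Let $E=\bigsqcup_{n\in\omega}E_n$ be a continuous signature and let $X$ be a topological $E$-algebra with structure maps $\mathfrak e^X_n\colon E_n\times X^n\to X$. Suppose that for every $n\in\mathrm{Sp}\,E$ the space $X^n$ is pseudocompact and $(X^n,E_n)$ is a $C$-pair. Then for every $n\in\mathrm{Sp}\,E$ the map $\mathfrak e^X_n$ has a continuous extension $\mathfrak e^{\beta X}_n\colon E_n\times(\beta X)^n\to\beta X$. That is, $\beta X$ with the maps $\mathfrak e_n^{\beta X}$ is a topological $E$-algebra containing $X$ as a subalgebra.
   Context: All spaces are Tychonoff; $\beta X$ is the Stone–Čech compactification. A continuous signature is a space $E$ that is the disjoint union of clopen (possibly empty) subsets $E_n$, $n\in\omega=\{0,1,2,\dots\}$; $\mathrm{Sp}\,E=\{n\in\omega: E_n\ne\varnothing\}$. An $E$-algebra is a set $X$ with maps $\mathfrak e^X_n\colon E_n\times X^n\to X$, $n\in\omega$ ($X^0$ is a singleton). A topological $E$-algebra is an $E$-algebra endowed with a topology making all $\mathfrak e^X_n$ continuous. A subalgebra is a subset closed under all operations, with the restricted structure. A pair of spaces $(S,T)$ is a $C$-pair if every continuous function $S\times T\to\mathbb R$ has a continuous extension $\beta S\times T\to\mathbb R$. *)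

(* Defs.v *)
From HB Require Import structures.
From mathcomp Require Import all_boot all_order all_algebra.
From mathcomp Require Import all_classical all_reals all_analysis.
From mathcomp Require Import lra.

Set Implicit Arguments.
Unset Strict Implicit.
Unset Printing Implicit Defensive.
Import Order.TTheory GRing.Theory Num.Theory.
Import numFieldNormedType.Exports.

Local Open Scope classical_set_scope.
Local Open Scope ring_scope.

Definition tychonoff_space (T : topologicalType) : Prop :=
  completely_regular_space T /\ hausdorff_space T.

(* [X^n] with the product topology; for [n = 0] it has exactly one point. *)
Definition power (X : topologicalType) (n : nat) : topologicalType :=
  prod_topology (fun _ : 'I_n => X).

Definition map_power (X Y : topologicalType) (j : X -> Y) (n : nat)
  (x : power X n) : power Y n := fun i => j (x i).

Definition pseudocompact (R : realType) (S : topologicalType) : Prop :=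
  forall f : S -> R, continuous f -> bounded_set (range f).

Definition topological_embedding (X Y : topologicalType) (j : X -> Y) : Prop :=
  injective j /\
  (forall U : set X, open U <-> exists2 V : set Y, open V & j @^-1` V = U).

Section StoneCech.
Context (R : realType) (X : topologicalType).

Definition unit_fun : Type :=
  {f : X -> R | continuous f /\ forall x, 0 <= f x <= 1}.

Definition cube : topologicalType := prod_topology (fun _ : unit_fun => R).

Definition evaluation (x : X) : cube := fun f => sval f x.

(* Tychonoff's construction: the closure of the image of [X] in the cube
   [0,1]^C(X,[0,1]). The cube is taken inside R^C(X,[0,1]), in which
   [0,1]^C(X,[0,1]) is closed, so the closure is the same. *)
Definition stone_cech : topologicalType :=
  set_type (closure (range evaluation)).

Lemma evaluation_closure (x : X) : evaluation x \in closure (range evaluation).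
Proof. by apply/mem_set/subset_closure; exists x. Qed.

Definition stone_cech_unit (x : X) : stone_cech :=
  exist _ (evaluation x) (evaluation_closure x).

End StoneCech.

Section StoneCechTheory.
Context (R : realType) (X : topologicalType).
Local Notation bX := (stone_cech R X).
Local Notation eta := (@stone_cech_unit R X).

Lemma stone_cech_coord_continuous (f : unit_fun R X) :
  continuous (fun p : bX => (set_val p : cube R X) f).
Proof.
move=> p.
apply: (@continuous_comp bX (cube R X) R set_val (fun q : cube R X => q f)).
  exact: initial_continuous.
exact: (@proj_continuous {classic (unit_fun R X)} (fun=> R) f).
Qed.

Lemma cube_hausdorff : hausdorff_space (cube R X).
Proof.
have H (i : {classic (unit_fun R X)}) : hausdorff_space R.
  exact: norm_hausdorff.
exact: (hausdorff_product H).
Qed.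

Lemma stone_cech_hausdorff : hausdorff_space bX.
Proof.
move=> p q pq; apply: val_inj.
apply: cube_hausdorff => A B Ap Bq.
have cv : continuous (set_val : bX -> cube R X).
  by move=> ?; exact: initial_continuous.
have [r [Ar Br]] := pq _ _ (cv p _ Ap) (cv q _ Bq).
by exists (set_val r).
Qed.

Lemma stone_cech_compact : compact [set: bX].
Proof.
pose C : set (cube R X) := closure (range (@evaluation R X)).
have cK : compact [set f : cube R X | forall i, `[0, 1]%classic (f i)].
  apply: (@tychonoff {classic (unit_fun R X)} (fun=> R)
    (fun=> `[0, 1]%classic)) => _.
  exact: segment_compact.
have clK : closed [set f : cube R X | forall i, `[0, 1]%classic (f i)].
  by apply: compact_closed => //; exact: cube_hausdorff.
have CK : C `<=` [set f : cube R X | forall i, `[0, 1]%classic (f i)].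
  rewrite [X in _ `<=` X](closure_id _).1 //.
  apply: closureS => _ [x _ <-] i /=.
  by rewrite in_itv /=; exact: (svalP i).2.
have cC : compact C.
  by apply: (subclosed_compact _ cK CK); exact: closed_closure.
move=> F PF _.
pose v : bX -> cube R X := set_val.
have Cv q : C (v q) by case: q => q qC; exact: set_mem qC.
have [|p [Cp clp]] := cC (v @ F) (fmap_proper_filter _ PF).
  exact: (@filterS _ F _ setT (v @^-1` C) (fun q _ => Cv q) filterT).
exists (exist _ p (mem_set Cp) : bX); split=> // A B FA [_ [[W oW <-] Wp WB]].
have FvA : (v @ F) (v @` A).
  apply: (@filterS _ F _ A (v @^-1` (v @` A)) _ FA) => q Aq.
  by exists q.
have [_ [[q Aq <-] Wq]] := clp _ _ FvA (open_nbhs_nbhs (conj oW Wp)).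
by exists q; split => //; exact: WB.
Qed.

Lemma stone_cech_unit_continuous : continuous eta.
Proof.
apply/continuousP => _ [W oW <-]; move: W oW; apply/continuousP.
move=> x; apply/cvg_sup => f; apply/cvg_image.
  by rewrite eqEsubset; split => // r _; exists (fun=> r).
move=> A fxA; have := (svalP f).1 x A fxA; rewrite nbhs_simpl /= => xA.
exists [set g : cube R X | A (g f)] => //.
by rewrite eqEsubset; split => [_ [g Ag <-]//|r Ar]; exists (fun=> r).
Qed.

Lemma stone_cech_unit_dense : dense (range eta).
Proof.
move=> O [[p pC] Op] [W oW WO]; move: Op; rewrite -WO => Wp.
have [_ [[x _ <-] Wx]] := set_mem pC W (open_nbhs_nbhs (conj oW Wp)).
by exists (eta x); split => //; exists x.
Qed.

Lemma stone_cech_extension (f : X -> R) :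
  continuous f -> bounded_set (range f) ->
  exists2 g : bX -> R, continuous g & forall x, g (eta x) = f x.
Proof.
move=> cf /ex_strict_bound_gt0 [M M0 fM].
have fb x : - M <= f x <= M.
  by rewrite -ler_norml; apply/ltW/fM; exists x.
pose h x := (f x + M) / (2 * M).
have ch : continuous h.
  move=> x; apply: cvgM; last exact: cvg_cst.
  by apply: cvgD; [exact: cf|exact: cvg_cst].
have h01 x : 0 <= h x <= 1.
  have /andP[? ?] := fb x.
  by rewrite /h ler_pdivlMr ?ler_pdivrMr ?mulr_gt0// mul0r mul1r; lra.
pose i : unit_fun R X := exist _ h (conj ch h01).
exists (fun p : bX => (set_val p : cube R X) i * (2 * M) - M).
  move=> p.
  have cp := @stone_cech_coord_continuous i p.
  have c1 : cst (2 * M) @ nbhs p --> 2 * M by exact: cvg_cst.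
  have c2 : cst M @ nbhs p --> M by exact: cvg_cst.
  exact: (cvgB (cvgM cp c1) c2).
by move=> x /=; rewrite /evaluation /= /h divfK ?addrK// mulf_neq0// ?gt_eqF.
Qed.

End StoneCechTheory.

Definition C_pair (R : realType) (S T : topologicalType) : Prop :=
  forall f : S * T -> R, continuous f ->
  exists2 g : stone_cech R S * T -> R, continuous g &
    forall s t, g (stone_cech_unit R s, t) = f (s, t).

Definition continuous_signature (E : topologicalType) (E_ : nat -> set E) :
    Prop :=
  [/\ tychonoff_space E, forall n, clopen (E_ n), trivIset setT E_ &
      \bigcup_n E_ n = setT].

Definition Sp (E : topologicalType) (E_ : nat -> set E) : set nat :=
  [set n | E_ n !=set0].

Section Algebras.
Context (E : topologicalType) (E_ : nat -> set E).

(* [E_ n] stands for the subtype [set_type (E_ n)] with the subspace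
   topology. *)
Definition operations (X : topologicalType) : Type :=
  forall n, E_ n * power X n -> X.

Definition topological_algebra (X : topologicalType) (op : operations X) :
    Prop :=
  tychonoff_space X /\ forall n, continuous (op n).

Definition subalgebra (Y : topologicalType) (op : operations Y) (A : set Y) :
    Prop :=
  forall n (c : E_ n) (y : power Y n), (forall i, A (y i)) -> A (op n (c, y)).

(* [X] is identified with the subspace [range j] of [Y]: this subset is a
   subalgebra of [Y], and its restricted structure is that of [X]. *)
Definition subalgebra_via (X Y : topologicalType) (j : X -> Y)
    (opX : operations X) (opY : operations Y) : Prop :=
  [/\ topological_embedding j, subalgebra opY (range j) &
      forall n (c : E_ n) (x : power X n),
        opY n (c, map_power j x) = j (opX n (c, x))].

End Algebras.

(* Main.v *)
(* Continuous functions on a pseudocompact power [X^n] are equicontinuous in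
   each coordinate: otherwise one builds a sequence of nonempty open boxes
   without cluster point. Hence [sup_s |f s(i:=x) - f s(i:=y)|] is a continuous
   pseudometric on [X]; by pseudocompactness it is totally bounded, so it is
   small near every point of [beta X]. Changing the coordinates one at a time,
   [f] has small oscillation near every point of [(beta X)^n] (this is
   Glicksberg's theorem). For [f] on [E_n * X^n] the C-pair hypothesis and
   compactness of [beta (X^n)] give equicontinuity in the variable of [E_n], so
   the oscillation is also small near every point of [E_n * (beta X)^n], and
   the operations extend by density. *)

Require Import Defs.
From mathcomp Require Import all_boot all_order all_algebra.
From mathcomp Require Import all_classical all_reals all_analysis.
From mathcomp Require Import lra.
Import Order.TTheory GRing.Theory Num.Theory.
Import numFieldNormedType.Exports.
Set Implicit Arguments.
Unset Strict Implicit.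
Unset Printing Implicit Defensive.
Local Open Scope classical_set_scope.
Local Open Scope ring_scope.

(** * Bump functions on pseudocompact and on completely regular spaces *)

Section Bumps.
Context (R : realType).

Lemma continuous_distP (T : topologicalType) (f : T -> R) :
  continuous f <->
  forall x e, 0 < e -> nbhs x [set y | `|f x - f y| < e].
Proof.
split=> cf x; first by move=> e e0; exact: (cvgrPdist_lt _ _).1 (cf x) e e0.
by apply/cvgrPdist_lt => e e0; exact: cf.
Qed.

(** If the bumps had no cluster point they would be locally finite, and the sum of [n * phi n] would
    be continuous with value at least [n] at [a n]. *)
Lemma pseudocompact_bumps_cluster (S : topologicalType) (phi : nat -> S -> R)
    (a : nat -> S) :
  pseudocompact R S ->
  (forall n, continuous (phi n)) -> (forall n x, 0 <= phi n x) ->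
  (forall n, phi n (a n) = 1) ->
  exists s : S, forall A, nbhs s A -> forall N,
    exists n t, [/\ (N <= n)%N, A t & phi n t != 0].
Proof.
move=> pS cphi phi0 phia; apply: contrapT => /forallNP nocluster.
have /choice[B HB] (s : S) : exists B : set S * nat, nbhs s B.1 /\
    forall n t, (B.2 <= n)%N -> B.1 t -> phi n t = 0.
  have /existsNP[A /not_implyP[sA /existsNP[N nN]]] := nocluster s.
  exists (A, N); split=> //= n t Nn At; apply/eqP/negPn/negP => nt.
  by apply: nN; exists n, t.
(* A locally finite sum: near [s] only the terms below [(B s).2] survive. *)
pose F m s := \sum_(0 <= i < m) i%:R * phi i s.
have FE m s : ((B s).2 <= m)%N -> F m s = F (B s).2 s.
  move=> Nm; rewrite /F (big_cat_nat (leq0n _) Nm) /= [X in _ + X]big_nat_cond.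
  rewrite [X in _ + X]big1 ?addr0// => i /andP[/andP[Ni _] _].
  by rewrite (HB s).2 ?mulr0//; apply: nbhs_singleton; exact: (HB s).1.
have cF m : continuous (F m).
  elim: m => [|m IHm] s.
    rewrite (_ : F 0 = cst 0); first exact: cvg_cst.
    by apply/funext => t; rewrite /F big_geq.
  rewrite (_ : F m.+1 = fun t => F m t + m%:R * phi m t); last first.
    by apply/funext => t; rewrite /F big_nat_recr.
  by apply: cvgD; [exact: IHm|apply: cvgM; [exact: cvg_cst|exact: cphi]].
have cG : continuous (fun s => F (B s).2 s).
  move=> s; apply: cvg_trans (cF (B s).2 s).
  apply: near_eq_cvg; apply: filterS (HB s).1 => t Bt.
  (* The cutoffs at [s] and [t] are compared through their maximum: the terms between [(B s).2] and
     [m] vanish at [t], which lies in [(B s).1]. *)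
  pose m := maxn (B s).2 (B t).2.
  rewrite -(FE m t) ?leq_maxr// /F.
  rewrite (big_cat_nat (leq0n _) (leq_maxl (B s).2 _)) /=.
  rewrite [X in _ + X]big_nat_cond [X in _ + X]big1 ?addr0//.
  by move=> i /andP[/andP[Ni _] _]; rewrite (HB s).2 ?mulr0.
have /ex_strict_bound_gt0[M M0 FM] := pS _ cG.
(* [n.+1] exceeds [M] and is the coefficient of the bump at [a n.+1]; the cutoff [n.+2] below makes
   the sum reach that term. *)
pose n := Num.truncn M; pose b := a n.+1.
have := FM _ (imageT _ b); rewrite /= ltNge => /negP; apply.
apply: le_trans (ler_norm _).
pose m := maxn (B b).2 n.+2.
rewrite -(FE m) ?leq_maxl// /F (@big_rem _ _ _ _ _ n.+1) /=; last first.
  by rewrite mem_index_iota /= leq_maxr.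
rewrite phia mulr1 ler_wpDr ?sumr_ge0// => [i _|]; first by rewrite mulr_ge0.
by apply/ltW/truncnS_gt.
Qed.

Lemma continuous_mul (T : topologicalType) (f g : T -> R) :
  continuous f -> continuous g -> continuous (fun z => f z * g z).
Proof. by move=> cf cg z; apply: cvgM; [exact: cf|exact: cg]. Qed.

(* A filter, so that comparing it with a product neighbourhood filter reduces
   to the coordinates. *)
Definition bump_nbhs (T : topologicalType) (s : T) : set_system T :=
  [set A | exists b : T -> R, [/\ continuous b, forall z, 0 <= b z, b s = 1 &
    forall z, b z != 0 -> A z]].

Global Instance bump_nbhs_filter (T : topologicalType) (s : T) :
  Filter (bump_nbhs s).
Proof.
split.
- by exists (cst 1); split=> // z; exact: cvg_cst.
- move=> A B [a [ca a0 as1 aA]] [b [cb b0 bs1 bB]].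
  exists (fun z => a z * b z); split.
  + exact: continuous_mul.
  + by move=> z; rewrite mulr_ge0.
  + by rewrite as1 bs1 mulr1.
  + by move=> z; rewrite mulf_eq0 negb_or => /andP[/aA + /bB].
- by move=> A B AB [a [ca a0 as1 aA]]; exists a; split=> // z /aA /AB.
Qed.

Lemma completely_regular_unit_fun (T : topologicalType) (s : T) (A : set T) :
  completely_regular_space T -> nbhs s A ->
  exists f : unit_fun R T, sval f s = 0 /\ forall z, ~ A z -> sval f z = 1.
Proof.
move=> crT; rewrite nbhsE => -[U [oU Us] UA].
have /(uniform_separatorP (R := R))[f [cf f01 fs fU]] :
  uniform_separator [set s] (~` U) by apply: crT => //; exact: open_closedC.
have f01' z : 0 <= f z <= 1.
  by have := f01 _ (imageT f z); rewrite /= in_itv.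
exists (exist _ f (conj cf f01')); split=> [|z nAz] /=.
  by apply: fs; exists s.
by apply: fU; exists z => // /UA.
Qed.

Lemma completely_regular_bump (T : topologicalType) (s : T) :
  completely_regular_space T -> nbhs s `<=` bump_nbhs s.
Proof.
move=> crT A sA.
have [[f [cf f01]] /= [fs fA]] := completely_regular_unit_fun crT sA.
exists (fun z => 1 - f z); split.
- by move=> z; apply: cvgB; [exact: cvg_cst|exact: cf].
- by move=> z; have /andP[_] := f01 z; rewrite subr_ge0.
- by rewrite fs subr0.
- by move=> z; apply: contraNP => nAz; rewrite fA// subrr.
Qed.

End Bumps.

(** * Finite powers and equicontinuity in one coordinate *)

Section Power.
Context (R : realType) (X : topologicalType) (n : nat).
Implicit Types (s : power X n) (i : 'I_n).

Lemma power_proj_continuous i : continuous (fun s => s i).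
Proof. exact: (@proj_continuous 'I_n (fun=> X) i). Qed.

Lemma cvg_power (F : set_system (power X n)) s : Filter F ->
  (forall i, (fun z : power X n => z i) @ F --> s i) -> F --> s.
Proof.
move=> FF Fs; apply/cvg_sup => i A [_ [[W oW <-] Ws WA]].
by apply: filterS WA _; apply: Fs; exact: open_nbhs_nbhs.
Qed.

(** Bumps multiply, so [bump_nbhs] is a filter and it is enough to pull back a bump along each
    projection. *)
Lemma power_bump s : completely_regular_space X -> nbhs s `<=` bump_nbhs R s.
Proof.
move=> crX; apply: (@cvg_power (bump_nbhs R s) s _) => i A.
move=> /(completely_regular_bump R crX)[b [cb b0 bs bA]]; exists (fun z => b (z i)).
split=> // z; last exact: bA.
by apply: (@continuous_comp _ _ _ (fun z : power X n => z i));
  [exact: power_proj_continuous|exact: cb].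
Qed.

Definition update i (x : X) s : power X n :=
  fun j => if j == i then x else s j.

Lemma continuous_power (Z : topologicalType) (g : Z -> power X n) :
  (forall i, continuous (fun z => g z i)) -> continuous g.
Proof. by move=> cg z; apply: cvg_power => i; exact: cg. Qed.

Lemma update_continuous i :
  continuous (fun xs : X * power X n => update i xs.1 xs.2).
Proof.
apply: continuous_power => j; rewrite /update; case: (j == i) => xs.
  exact: cvg_fst.
apply: (@continuous_comp _ _ _ snd (fun s => s j)); first exact: cvg_snd.
exact: power_proj_continuous.
Qed.

Lemma update_continuousr i x : continuous (update i x).
Proof.
apply: continuous_power => j; rewrite /update; case: (j == i).
  exact: cst_continuous.
exact: power_proj_continuous.
Qed.

Lemma update_id i s : update i (s i) s = s.
Proof. by apply/funext => j; rewrite /update; case: eqP => // ->. Qed.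

Lemma update_update i x y s : update i x (update i y s) = update i x s.
Proof. by apply/funext => j; rewrite /update; case: eqP. Qed.

Lemma update_in i x s : update i x s i = x.
Proof. by rewrite /update eqxx. Qed.


(** A failure at [x0] yields bad pairs in ever smaller neighbourhoods of [x0], each with a box
    around it; pseudocompactness makes the boxes accumulate at a point [z], where continuity of [F]
    is contradicted. *)
Lemma update_equicontinuous (f : power X n -> R) i (x0 : X) (eps : R) :
  completely_regular_space X -> pseudocompact R (power X n) ->
  continuous f -> 0 < eps ->
  exists2 U, nbhs x0 U &
    forall x s, U x -> `|f (update i x s) - f (update i x0 s)| <= eps.
Proof.
move=> crX pcX cf eps0; apply: contrapT => noU.
pose F (xs : X * power X n) := f (update i xs.1 xs.2).
have cF : continuous F.
  move=> xs; apply: (@continuous_comp _ _ _ (fun xs => update i xs.1 xs.2) f).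
    exact: update_continuous.
  exact: cf.
have FE t s : F (t, update i x0 s) = F (t, s) by rewrite /F /= update_update.
have near_box x s e : 0 < e -> exists A B, [/\ nbhs x A, nbhs s B &
    forall t z, A t -> B z -> `|F (x, s) - F (t, z)| < e].
  move=> e0.
  have [[A B] /= [nA nB] AB] := (continuous_distP F).1 cF (x, s) e e0.
  by exists A, B; split=> // t z At Bz; apply: (AB (t, z)).
(* Four approximations within [eps / 5] will contradict a gap above [eps]. *)
pose e := eps / 5; have e0 : 0 < e by rewrite /e; lra.
(* From [U], the tuple [d] collects a bad pair, bumps for its two factors, and the next
   neighbourhood of [x0]. *)
have /choice[d dP] (U : {U : set X | nbhs x0 U}) :
    exists d : (X * power X n) * ((X -> R) * (power X n -> R))
      * {U : set X | nbhs x0 U},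
    [/\ [/\ continuous d.1.2.1, forall t, 0 <= d.1.2.1 t &
          d.1.2.1 d.1.1.1 = 1],
        [/\ continuous d.1.2.2, forall z, 0 <= d.1.2.2 z &
          d.1.2.2 (update i x0 d.1.1.2) = 1],
        eps < `|F (d.1.1.1, d.1.1.2) - F (x0, d.1.1.2)|,
        (forall t, d.1.2.1 t != 0 -> sval U t) /\
        (forall t, sval d.2 t -> sval U t) &
        forall z, d.1.2.2 z != 0 ->
          (forall t, d.1.2.1 t != 0 ->
             `|F (d.1.1.1, d.1.1.2) - F (t, z)| < e) /\
          (forall t, sval d.2 t -> `|F (x0, d.1.1.2) - F (t, z)| < e)].
  have [x [s [Ux xs]]] : exists x s, nbhs x (sval U) /\
      eps < `|F (x, s) - F (x0, s)|.
    apply: contrapT => nxs; apply: noU.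
    exists (interior (sval U)) => [|x s Ux].
      exact/nbhs_interior/(svalP U).
    by rewrite leNgt; apply/negP => lt; apply: nxs; exists x, s.
  have [A [B [nA nB AB]]] := near_box x (update i x0 s) _ e0.
  have [A' [B' [nA' nB' AB']]] := near_box x0 (update i x0 s) _ e0.
  have [a [ca a0 ax aA]] := completely_regular_bump R crX (filterI nA Ux).
  have [b [cb b0 bs bB]] := power_bump crX (filterI nB nB').
  exists ((x, s), (a, b), exist _ _ (filterI nA' (svalP U))) => /=.
  split=> //.
    by split=> [t /aA[]|t []].
  move=> z /bB[Bz Bz']; rewrite -(FE x) -(FE x0); split=> t.
    by move=> /aA[At _]; exact: AB.
  by move=> [At _]; exact: AB'.
have x0T : nbhs x0 [set: X] by exact: filterT.
pose U k := iter k (fun U => (d U).2) (exist (nbhs x0) setT x0T).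
have U_mono k m t : (k <= m)%N -> sval (U m) t -> sval (U k) t.
  elim: m => [|m IHm]; first by rewrite leqn0 => /eqP ->.
  rewrite leq_eqVlt ltnS => /predU1P[->//|km Umt]; apply: IHm => //.
  by have [_ _ _ [_ sub] _] := dP (U m); exact: sub.
(* The first factor tests coordinate [i]; the second sees only the other coordinates, because
   coordinate [i] is reset to [x0]. *)
pose phi k (z : power X n) :=
  (d (U k)).1.2.1 (z i) * (d (U k)).1.2.2 (update i x0 z).
pose p k := update i (d (U k)).1.1.1 (d (U k)).1.1.2.
(* A cluster point [z] of the bumps has its coordinate [z i] adherent to every
   [U k], and the [a]-supports of the later bumps lie in [U k.+1]; comparing the
   values of [F] at both on one box around [z] contradicts the gap. *)
have [z zcl] : exists z : power X n, forall A, nbhs z A -> forall N,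
    exists k t, [/\ (N <= k)%N, A t & phi k t != 0].
  apply: (pseudocompact_bumps_cluster (a := p)) pcX _ _ _ => k.
  - have [[ca _ _] [cb _ _] _ _ _] := dP (U k); apply: continuous_mul => z.
      apply: (@continuous_comp _ _ _ (fun z : power X n => z i)
        (d (U k)).1.2.1).
        exact: power_proj_continuous.
      exact: ca.
    apply: (@continuous_comp _ _ _ (fun z : power X n => update i x0 z)
      (d (U k)).1.2.2).
      exact: update_continuousr.
    exact: cb.
  - have [[_ a0 _] [_ b0 _] _ _ _] := dP (U k) => z.
    by rewrite /phi mulr_ge0.
  - have [[_ _ a1] [_ _ b1] _ _ _] := dP (U k).
    by rewrite /phi /p update_in update_update a1 b1 mulr1.
have [A [B [nA nB AB]]] := near_box (z i) z e e0.
have nAB : nbhs z (B `&` (fun z : power X n => z i) @^-1` A).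
  by apply: filterI => //; exact: power_proj_continuous.
have [k [t [_ [Bt At]]]] := zcl _ nAB 0.
rewrite mulf_eq0 negb_or => /andP[akt bkt].
have [m [t' [km [_ At']]]] := zcl _ nAB k.+1.
rewrite mulf_eq0 negb_or => /andP[amt' _].
have [_ _ gap [_ _] /(_ _ bkt)[/(_ _ akt) near1 near2]] := dP (U k).
have /near2 {}near2 : sval (U k.+1) (t' i).
  have [_ _ _ [aU _] _] := dP (U m).
  by apply: U_mono km _; exact: aU.
move: near1 near2 gap (AB _ _ At Bt) (AB _ _ At' Bt).
rewrite !FE /e !ltr_norml ltr_normr.
move: (F _) (F _) (F _) (F _) (F _) => v1 v2 v3 v4 v5.
by move=> /andP[? ?] /andP[? ?] /orP[] ? /andP[? ?] /andP[? ?]; lra.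
Qed.

End Power.

(** * Continuous pseudometrics near points of the compactification *)

Section SmallNeighbourhoods.
Context (R : realType) (X : topologicalType).

Lemma stone_cech_unit_nbhs (p : stone_cech R X) (N : set (stone_cech R X)) :
  nbhs p N -> exists x, N (stone_cech_unit R x).
Proof.
move=> pN; have [q []] := @stone_cech_unit_dense R X _ (ex_intro _ p pN)
  (open_interior _).
by move=> /interior_subset Nq [x _ xq]; exists x; rewrite xq.
Qed.

(** Each [d x] is bounded, hence extends to some [h x]. Either some [h x] is small at [p], and a
    ball around [x] works, or there is an infinite uniformly separated sequence, which
    pseudocompactness forbids. *)
Lemma pseudometric_small_nbhs (d : X -> X -> R) (p : stone_cech R X) (e : R) :
  pseudocompact R X -> (forall x, continuous (d x)) ->
  (forall x, d x x = 0) -> (forall x y, d x y = d y x) ->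
  (forall x y z, d x z <= d x y + d y z) -> 0 < e ->
  exists2 N, nbhs p N & forall x y,
    N (stone_cech_unit R x) -> N (stone_cech_unit R y) -> d x y <= e.
Proof.
move=> pcX cd dxx dC dT e0.
have d_ge0 x y : 0 <= d x y by have := dT x y x; rewrite dxx (dC y x); lra.
have /choice[h hP] (x : X) : exists h : stone_cech R X -> R,
    continuous h /\ forall y, h (stone_cech_unit R y) = d x y.
  have [h ch hd] := stone_cech_extension (cd x) (pcX _ (cd x)).
  by exists h.
have ch x : continuous (h x) by exact: (hP x).1.
have hE x y : h x (stone_cech_unit R y) = d x y by exact: (hP x).2.
have [[x xp]|far] := pselect (exists x, h x p < e / 2).
  exists [set q | `|h x p - h x q| < e / 2 - h x p].
    by apply: (continuous_distP _).1 => //; lra.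
  move=> y z; rewrite /= !hE !ltr_norml => /andP[? ?] /andP[? ?].
  by have := dT y x z; rewrite (dC y x); lra.
have {}far x : e / 2 <= h x p.
  by rewrite leNgt; apply/negP => lt; apply: far; exists x.
(* No small ball comes near [p], so the points [a (U k)], chosen ever closer to
   [p], are pairwise more than [e / 4] apart. *)
have /choice[a aP] (O : {O : set (stone_cech R X) | nbhs p O}) :
    exists x, sval O (stone_cech_unit R x).
  by have [x Ox] := stone_cech_unit_nbhs (svalP O); exists x.
have next_nbhs (O : {O : set (stone_cech R X) | nbhs p O}) :
    nbhs p (sval O `&` [set q | e / 4 < h (a O) q]).
  apply: filterI; first exact: (svalP O).
  have e4 : 0 < e / 4 by lra.
  apply: filterS ((continuous_distP _).1 (ch (a O)) p _ e4) => q /=.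
  by have := far (a O); rewrite ltr_norml => ? /andP[? ?]; lra.
have pT : nbhs p [set: stone_cech R X] by exact: filterT.
pose U k := iter k (fun O => exist _ _ (next_nbhs O)) (exist (nbhs p) _ pT).
have U_mono k m q : (k <= m)%N -> sval (U m) q -> sval (U k) q.
  elim: m => [|m IHm]; first by rewrite leqn0 => /eqP ->.
  by rewrite leq_eqVlt ltnS => /predU1P[->//|km [Umq _]]; exact: IHm.
have sep k m : (k < m)%N -> e / 4 < d (a (U k)) (a (U m)).
  by move=> km; have [_] := U_mono _ _ _ km (aP (U m)); rewrite -hE.
(* [u k] is positive exactly on the ball of radius [e / 16] around [a (U k)], and [phi k] is its
   positive part. A cluster point is then within [e / 8] of two centres that are more than [e / 4]
   apart. *)
pose u k y : R := 1 - 16 / e * d (a (U k)) y.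
pose phi k y := (u k y + `|u k y|) / 2.
have [z zcl] : exists z : X, forall A, nbhs z A -> forall N,
    exists k t, [/\ (N <= k)%N, A t & phi k t != 0].
  apply: (pseudocompact_bumps_cluster (a := fun k => a (U k))) pcX _ _ _ => k.
  - have cu : continuous (u k).
      move=> y; apply: cvgB; first exact: cvg_cst.
      by apply: cvgM; [exact: cvg_cst|exact: cd].
    apply: continuous_mul; last exact: cst_continuous.
    by move=> y; apply: cvgD; [exact: cu|apply: cvg_norm; exact: cu].
  - move=> y; rewrite divr_ge0//.
    by have := ler_norm (- u k y); rewrite normrN; lra.
  - by rewrite /phi /u dxx mulr0 subr0 normr1; lra.
have e16 : 0 < e / 16 by lra.
have near_z := (continuous_distP _).1 (cd z) z _ e16.
have close k t : `|d z z - d z t| < e / 16 -> phi k t != 0 ->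
    d (a (U k)) z < e / 8.
  rewrite dxx sub0r normrN ger0_norm// => zt kt.
  have : 0 < u k t.
    rewrite ltNge; apply: contra kt => /ler0_norm ukt.
    by rewrite /phi ukt subrr mul0r.
  rewrite /u subr_gt0 mulrC mulrA ltr_pdivrMr// mul1r => ut.
  by have := dT (a (U k)) t z; rewrite (dC t z); lra.
have [k [t [_ zt /(close _ _ zt) kz]]] := zcl _ near_z 0.
have [m [t' [km zt' /(close _ _ zt') mz]]] := zcl _ near_z k.+1.
have := sep _ _ km; have := dT (a (U k)) z (a (U m)).
by rewrite (dC z); lra.
Qed.

(** The index [i] excludes the one-point power [n = 0], which carries no information about [X]. *)
Lemma pseudocompact_factor n (i : 'I_n) :
  pseudocompact R (power X n) -> pseudocompact R X.
Proof.
move=> pcX f cf; have /pcX : continuous (fun z : power X n => f (z i)).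
  move=> z; apply: (@continuous_comp _ _ _ (fun z : power X n => z i) f).
    exact: power_proj_continuous.
  exact: cf.
congr bounded_set; rewrite eqEsubset; split=> _ [x _ <-]; first by exists (x i).
by exists (fun=> x).
Qed.

End SmallNeighbourhoods.

(** * Oscillation of functions on a power, first alone and then with a parameter *)

Section Oscillation.
Context (R : realType) (X : topologicalType) (n : nat).

Lemma update_small_nbhs (f : power X n -> R) (i : 'I_n) (p : stone_cech R X)
    (e : R) :
  completely_regular_space X -> pseudocompact R (power X n) ->
  continuous f -> 0 < e ->
  exists2 N, nbhs p N & forall x y s,
    N (stone_cech_unit R x) -> N (stone_cech_unit R y) ->
    `|f (update i x s) - f (update i y s)| <= e.
Proof.
move=> crX pcX cf e0.
have /ex_strict_bound_gt0[M M0 fM] := pcX _ cf.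
pose D x y : set R := range (fun s => `|f (update i x s) - f (update i y s)|).
pose d x y := sup (D x y).
have D_ub x y s : `|f (update i x s) - f (update i y s)| <= d x y.
  apply: ub_le_sup; last by exists s.
  exists (2 * M) => _ [z _ <-].
  apply: (le_trans (ler_normB _ _)).
  have := fM _ (imageT f (update i x z)).
  have := fM _ (imageT f (update i y z)).
  by rewrite /=; lra.
have d_le x y c : (forall s, `|f (update i x s) - f (update i y s)| <= c) ->
    d x y <= c.
  move=> le_c; apply: ge_sup; last by move=> _ [s _ <-]; exact: le_c.
  exists (`|f (update i x (fun=> x)) - f (update i y (fun=> x))|).
  by exists (fun=> x).
have dT x y z : d x z <= d x y + d y z.
  apply: d_le => s; apply: (le_trans (ler_distD (f (update i y s)) _ _)).
  by rewrite lerD.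
have dC x y : d x y = d y x.
  by apply/eqP; rewrite eq_le; apply/andP; split; apply: d_le => s;
    rewrite distrC.
have dxx x : d x x = 0.
  apply/eqP; rewrite eq_le; apply/andP; split.
    by apply: d_le => s; rewrite subrr normr0.
  by apply: le_trans (D_ub x x (fun=> x)).
have cd x : continuous (d x).
  (* The supremum inherits only a weak bound; halving [c] makes it strict. *)
  apply/continuous_distP => y c c0; have c2 : 0 < c / 2 by lra.
  have [U yU Uc] := update_equicontinuous i y crX pcX cf c2.
  apply: filterS yU => z Uz.
  have : d z y <= c / 2 by apply: d_le => s; exact: Uc.
  have := dT x y z; have := dT x z y; rewrite (dC y z) /= ltr_norml => ? ? ?.
  by apply/andP; split; lra.
have [N pN Ne] :=
  pseudometric_small_nbhs p (pseudocompact_factor i pcX) cd dxx dC dT e0.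
by exists N => // x y s Nx Ny; apply: le_trans (D_ub x y s) (Ne _ _ Nx Ny).
Qed.

Definition box_nbhs (p : power X n) : set_system (power X n) :=
  [set A | exists2 N : 'I_n -> set X, forall i, nbhs (p i) (N i) &
    forall q : power X n, (forall i, N i (q i)) -> A q].

Global Instance box_nbhs_filter (p : power X n) : Filter (box_nbhs p).
Proof.
split.
- by exists (fun=> setT) => // i; exact: filterT.
- move=> A B [N pN NA] [M pM MB]; exists (fun i => N i `&` M i).
    by move=> i; exact: filterI.
  by move=> q NM; split; [apply: NA|apply: MB] => i; have [] := NM i.
- by move=> A B AB [N pN NA]; exists N => // q /NA /AB.
Qed.

Lemma nbhs_box (p : power X n) : nbhs p `<=` box_nbhs p.
Proof.
apply: (@cvg_power _ _ (box_nbhs p) p _) => i A pA.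
exists (fun j => if j == i then A else setT).
  by move=> j; case: eqP => [->//|_]; exact: filterT.
by move=> q /(_ i); rewrite eqxx.
Qed.

Lemma nbhs_power_box (p : power X n) (N : 'I_n -> set X) :
  (forall i, nbhs (p i) (N i)) -> nbhs p [set q | forall i, N i (q i)].
Proof.
move=> pN; apply: (@filter_forall _ _ (fun i q => N i (q i)) (nbhs p)) => i.
exact: (@power_proj_continuous X n i p) (pN i).
Qed.

End Oscillation.

Lemma power_small_nbhs (R : realType) (X : topologicalType) (n : nat)
    (f : power X n -> R) (p : power (stone_cech R X) n) (e : R) :
  completely_regular_space X -> pseudocompact R (power X n) ->
  continuous f -> 0 < e ->
  exists2 N, nbhs p N & forall z z',
    N (map_power (@stone_cech_unit R X) z) ->
    N (map_power (@stone_cech_unit R X) z') -> `|f z - f z'| <= e.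
Proof.
(* At most [n] changes of size [e / n.+1] add up to at most [e]; the successor keeps the quotient
   positive for [n = 0]. *)
move=> crX pcX cf e0; have en0 : 0 < e / n.+1%:R by rewrite divr_gt0.
have /choice[N HN] (i : 'I_n) : exists N, nbhs (p i) N /\ forall x y s,
    N (stone_cech_unit R x) -> N (stone_cech_unit R y) ->
    `|f (update i x s) - f (update i y s)| <= e / n.+1%:R.
  have [N pN Ne] := update_small_nbhs i (p i) crX pcX cf en0.
  by exists N.
exists [set q | forall i, N i (q i)].
  by apply: nbhs_power_box => i; exact: (HN i).1.
move=> z z' Nz Nz'.
(* [h] interpolates from [z] to [z'], one coordinate at a time. *)
pose h k : power X n := fun j => if (j < k)%N then z' j else z j.
have hz : h 0 = z by apply/funext.
have hz' : h n = z' by apply/funext => j; rewrite /h ltn_ord.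
have hk k : (k <= n)%N -> `|f z - f (h k)| <= k%:R * (e / n.+1%:R).
  elim: k => [|k IHk] kn; first by rewrite hz subrr normr0 mul0r.
  pose i := Ordinal kn.
  have hS : h k.+1 = update i (z' i) (h k).
    apply/funext => j; rewrite /h /update -val_eqE /= ltnS leq_eqVlt.
    by case: eqP => [ji|//]; rewrite (_ : j = i)//; exact: val_inj.
  (* [h k] still has [z i] at coordinate [i]; written as an update, it differs from [h k.+1] only in
     the value put there, so the bound for [N i] applies. *)
  have hE : h k = update i (z i) (h k).
    by rewrite -[in LHS](update_id i (h k)) /h /= ltnn.
  apply: (le_trans (ler_distD (f (h k)) _ _)).
  rewrite -natr1 mulrDl mul1r lerD ?IHk//; first exact: ltnW.
  by rewrite hS [in X in `|X - _|]hE; apply: (HN i).2; [exact: Nz|exact: Nz'].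
rewrite -[in z']hz' (le_trans (hk n (leqnn n)))// mulrA ler_pdivrMr//.
by rewrite mulrC ler_pM2l// ler_nat.
Qed.

(** The extension [g] lives on a product with compact first factor, so the closeness of [g (q, c)]
    to [g (q, c0)] near each [q] becomes uniform in [q], as in the tube lemma. *)
Lemma C_pair_equicontinuous (R : realType) (S T : topologicalType)
    (f : S * T -> R) (c0 : T) (e : R) :
  C_pair R S T -> continuous f -> 0 < e ->
  nbhs c0 [set c | forall s, `|f (s, c) - f (s, c0)| <= e].
Proof.
move=> CST cf e0; have [g cg gf] := CST f cf.
have e2 : 0 < e / 2 by lra.
have near_q (q : stone_cech R S) : [set: stone_cech R S] q ->
    \forall q' \near q & c \near c0, `|g (q', c) - g (q', c0)| < e.
  move=> _.
  have [[A B] /= [qA cB] AB] := (continuous_distP _).1 cg (q, c0) _ e2.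
  exists (A, B) => //= -[q' c] /= [Aq' Bc].
  have := AB (q', c) (conj Aq' Bc).
  have := AB (q', c0) (conj Aq' (nbhs_singleton cB)).
  by rewrite /= !ltr_norml => /andP[? ?] /andP[? ?]; apply/andP; split; lra.
have := (compact_near_coveringP _).1 (@stone_cech_compact R S) _ (nbhs c0)
  (fun c q => `|g (q, c) - g (q, c0)| < e) (nbhs_filter c0) near_q.
move=> near_c; apply: filterS near_c => c gc s /=.
by rewrite -!gf; apply/ltW/gc.
Qed.

Lemma continuous_pair (Z U V : topologicalType) (g : Z -> U) (h : Z -> V) :
  continuous g -> continuous h -> continuous (fun z => (g z, h z)).
Proof. by move=> cg ch z; exact: cvg_pair (cg z) (ch z). Qed.

(** The path is [(c, z)], [(c0, z)], [(c0, z')], [(c', z')]: [C_pair_equicontinuous] bounds the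
    outer steps and [power_small_nbhs] the middle one. *)
Lemma C_pair_power_small_nbhs (R : realType) (X T : topologicalType) (n : nat)
    (f : T * power X n -> R) (c0 : T) (p : power (stone_cech R X) n) (e : R) :
  completely_regular_space X -> pseudocompact R (power X n) ->
  C_pair R (power X n) T -> continuous f -> 0 < e ->
  exists2 N, nbhs (c0, p) N & forall c z c' z',
    N (c, map_power (@stone_cech_unit R X) z) ->
    N (c', map_power (@stone_cech_unit R X) z') ->
    `|f (c, z) - f (c', z')| <= e.
Proof.
move=> crX pcX CXT cf e0; have e3 : 0 < e / 3 by lra.
pose f' (zc : power X n * T) := f (zc.2, zc.1).
have cf' : continuous f'.
  move=> zc; apply: (@continuous_comp _ _ _ (fun zc => (zc.2, zc.1)) f).
    by apply: continuous_pair => ?; [exact: cvg_snd|exact: cvg_fst].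
  exact: cf.
have cfc0 : continuous (fun z => f (c0, z)).
  move=> z; apply: (@continuous_comp _ _ _ (fun z => (c0, z)) f).
    by apply: continuous_pair; [exact: cst_continuous|move=> ?; exact: cvg_id].
  exact: cf.
have [N pN Nz] := power_small_nbhs p crX pcX cfc0 e3.
have c0B := C_pair_equicontinuous c0 CXT cf' e3.
exists [set cq | (forall s, `|f' (s, cq.1) - f' (s, c0)| <= e / 3) /\ N cq.2].
  exists ([set c | forall s, `|f' (s, c) - f' (s, c0)| <= e / 3], N) => //=.
move=> c z c' z' /= [/(_ z) cz Nz1] [/(_ z') cz' Nz'].
have := Nz _ _ Nz1 Nz'; move: cz cz'; rewrite /f' /= !ler_norml.
by move=> /andP[? ?] /andP[? ?] /andP[? ?]; apply/andP; split; lra.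
Qed.

(** * Extension of maps from a dense image *)

Section Extension.
Context (R : realType) (X D T : topologicalType).
Local Notation bX := (stone_cech R X).

(** [Phi t] is chosen as a cluster point of the values of [phi] near [t]; small oscillation of every
    cube coordinate makes these choices continuous. *)
Lemma dense_extension (j : D -> T) (phi : D -> bX) :
  (forall (t : T) A, nbhs t A -> exists x, A (j x)) ->
  (forall (f : unit_fun R X) (t : T) e, 0 < e -> exists2 N, nbhs t N &
    forall x y, N (j x) -> N (j y) ->
      `|(sval (phi x) : cube R X) f - (sval (phi y) : cube R X) f| <= e) ->
  exists2 Phi : T -> bX, continuous Phi & forall x, Phi (j x) = phi x.
Proof.
move=> dj osc.
have /choice[Phi PhiP] (t : T) : exists p : bX, forall A N,
    nbhs t A -> nbhs p N -> exists2 x, A (j x) & N (phi x).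
  have FF : Filter (filter_from (nbhs t) (fun A => phi @` (j @^-1` A))).
    apply: filter_from_filter; first by exists setT; exact: filterT.
    move=> A B tA tB; exists (A `&` B); first exact: filterI.
    by move=> _ [x [Ax Bx] <-]; split; exists x.
  have PF : ProperFilter (filter_from (nbhs t) (fun A => phi @` (j @^-1` A))).
    apply: filter_from_proper => A /dj[x Ax].
    by exists (phi x); exists x.
  have [|p [_ clp]] := @stone_cech_compact R X _ PF.
    by exists setT => //; exact: filterT.
  exists p => A N tA pN.
  have [|_ [[x Ax <-] Nx]] := clp (phi @` (j @^-1` A)) N _ pN.
    by exists A.
  by exists x.
(* The bound on the values of [phi] is a closed condition, so it passes to the cluster point. *)
have near_Phi (f : unit_fun R X) (t : T) N x e : 0 < e -> nbhs t N -> N (j x) ->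
    (forall y, N (j y) ->
      `|(sval (phi x) : cube R X) f - (sval (phi y) : cube R X) f| <= e) ->
    `|(sval (phi x) : cube R X) f - (sval (Phi t) : cube R X) f| <= e.
  move=> e0 tN Nx Ne; rewrite leNgt; apply/negP => gap.
  set v := _ - _ in gap.
  have d0 : 0 < `|v| - e by rewrite subr_gt0.
  have := (continuous_distP _).1 (@stone_cech_coord_continuous R X f) (Phi t) _ d0.
  move=> /(PhiP t _ _ tN)[y Ny /= yt].
  have := Ne y Ny; rewrite leNgt => /negP; apply.
  have := ler_distD ((sval (phi y) : cube R X) f)
    ((sval (phi x) : cube R X) f) ((sval (Phi t) : cube R X) f).
  rewrite -/v [X in _ <= _ + X]distrC.
  by move: yt; rewrite /=; lra.
have coord_cont (f : unit_fun R X) :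
    continuous (fun t => (sval (Phi t) : cube R X) f).
  apply/continuous_distP => t e e0; have e3 : 0 < e / 3 by lra.
  have [N tN Ne] := osc f t _ e3; have [x Nx] := dj _ _ tN.
  have near_x t' : nbhs t' N ->
      `|(sval (phi x) : cube R X) f - (sval (Phi t') : cube R X) f| <= e / 3.
    by move=> tN'; apply: (near_Phi f t' N) => // y Ny; exact: Ne.
  (* For [t'] interior to [N], the bound [near_x] holds at both [t] and [t'], which gives
     [2 * e / 3] in total. *)
  move: (nbhs_interior tN); apply: filterS => t' /near_x.
  have := near_x _ tN; rewrite /= ltr_norml !ler_norml.
  by move=> /andP[? ?] /andP[? ?]; apply/andP; split; lra.
exists Phi.
  apply: continuous_comp_initial => t; apply/cvg_sup => f A.
  move=> [_ [[W oW <-] Wt WA]].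
  by apply: filterS WA _; apply: coord_cont; exact: open_nbhs_nbhs.
move=> x; apply: val_inj; apply/funext => f; apply/eqP; rewrite eq_sym.
rewrite -subr_eq0 -normr_le0; apply/ler_addgt0Pr => e e0; rewrite add0r.
have [N tN Ne] := osc f (j x) _ e0; have Nx := nbhs_singleton tN.
by apply: (near_Phi f (j x) N x e e0 tN Nx) => y Ny; exact: Ne.
Qed.
End Extension.

(** * The compactification as an algebra containing the given one *)

Lemma stone_cech_tychonoff (R : realType) (X : topologicalType) :
  tychonoff_space (stone_cech R X).
Proof.
have hX := @stone_cech_hausdorff R X; split=> //.
apply: (@normal_completely_regular R).
  exact: compact_normal hX (@stone_cech_compact R X).
exact: hausdorff_accessible.
Qed.

(** A unit function separating a point from a closed set is itself a coordinate of the cube; this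
    gives both injectivity and the open sets. *)
Lemma stone_cech_unit_embedding (R : realType) (X : topologicalType) :
  tychonoff_space X -> topological_embedding (@stone_cech_unit R X).
Proof.
move=> [crX hX]; split=> [x y xy|U].
  apply/eqP/negPn/negP => /(hausdorff_accessible hX)[A [oA xA yA]].
  have [|f [fx fA]] := @completely_regular_unit_fun R X x A crX _.
    by apply: open_nbhs_nbhs; split=> //; exact: set_mem.
  have /(congr1 (fun p : stone_cech R X => (sval p : cube R X) f)) := xy.
  rewrite /= /evaluation fx fA; last exact: (set_mem yA).
  by move/eqP; rewrite eq_sym oner_eq0.
split=> [oU|[V oV <-]]; last first.
  exact: (continuousP _).1 (@stone_cech_unit_continuous R X) _ oV.
exists (\bigcup_(W in [set W | open W /\ @stone_cech_unit R X @^-1` W `<=` U]) W).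
  by apply: bigcup_open => W [].
rewrite eqEsubset; split=> [x [W [_ WU] Wx]|x Ux]; first exact: WU.
have [f [fx fU]] := completely_regular_unit_fun R crX
  (open_nbhs_nbhs (conj oU Ux)).
exists [set p | (sval p : cube R X) f < 1]; last by rewrite /= /evaluation fx.
split=> [|y /=]; last first.
  by rewrite /evaluation; apply: contraPP => /fU ->; rewrite ltxx.
exact: (continuousP _).1 (@stone_cech_coord_continuous R X f) _ (@open_lt R 1).
Qed.

(** Each cube coordinate of [f] is a real function on [T * power X n], so [C_pair_power_small_nbhs]
    provides the oscillation bound of [dense_extension]. *)
Lemma power_extension (R : realType) (X T : topologicalType) (n : nat)
    (f : T * power X n -> X) :
  completely_regular_space X -> pseudocompact R (power X n) ->
  C_pair R (power X n) T -> continuous f ->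
  exists2 F : T * power (stone_cech R X) n -> stone_cech R X, continuous F &
    forall c x, F (c, map_power (@stone_cech_unit R X) x) =
      stone_cech_unit R (f (c, x)).
Proof.
move=> crX pcX CXT cf.
pose j (cx : T * power X n) := (cx.1, map_power (@stone_cech_unit R X) cx.2).
have [||F cF FE] :=
  @dense_extension R X _ _ j (fun cx => stone_cech_unit R (f cx)).
- move=> [c p] A [[B N] /= [cB /nbhs_box[M pM MN]] BNA].
  have /choice[x Mx] i : exists x, M i (stone_cech_unit R x).
    exact: stone_cech_unit_nbhs (pM i).
  exists (c, x); apply: BNA; split=> /=; first exact: nbhs_singleton.
  exact: MN.
- move=> g [c p] e e0; pose h cx := sval g (f cx).
  have ch : continuous h.
    by move=> cx; apply: (@continuous_comp _ _ _ f (sval g));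
      [exact: cf|exact: (svalP g).1].
  have [N cpN Ne] := C_pair_power_small_nbhs c p crX pcX CXT ch e0.
  by exists N => // -[c1 x1] [c2 x2]; exact: Ne.
by exists F => // c x; have := FE (c, x).
Qed.

Theorem theorem5 (R : realType) (E : topologicalType) (E_ : nat -> set E)
    (X : topologicalType) (e : operations E_ X) :
  continuous_signature E_ ->
  topological_algebra e ->
  (forall n, Sp E_ n ->
    pseudocompact R (power X n) /\ C_pair R (power X n) (E_ n)) ->
  exists be : operations E_ (stone_cech R X),
    [/\ forall n, Sp E_ n ->
          continuous (be n) /\
          (forall (c : E_ n) (x : power X n),
             be n (c, map_power (@stone_cech_unit R X) x) =
             stone_cech_unit R (e n (c, x))),
        topological_algebra be &
        subalgebra_via (@stone_cech_unit R X) e be].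
Proof.
move=> _ [tyX ce] hyp; have [crX _] := tyX.
have ext n : exists F : E_ n * power (stone_cech R X) n -> stone_cech R X,
    continuous F /\ forall c x, F (c, map_power (@stone_cech_unit R X) x) =
      stone_cech_unit R (e n (c, x)).
  (* For [n] outside [Sp E_] the domain is empty and the empty map serves; [topological_algebra]
     asks for continuity at every [n]. *)
  have [Spn|nSpn] := pselect (Sp E_ n).
    have [pcX CXE] := hyp n Spn.
    by have [F cF FE] := power_extension crX pcX CXE (ce n); exists F.
  have En0 (c : E_ n) : False by apply: nSpn; exists (val c); exact: set_valP.
  by exists (fun cq => False_rect _ (En0 cq.1)); split=> [[c q]|c x];
    case: (En0 c).
pose be : operations E_ (stone_cech R X) := fun n => sval (cid (ext n)).
have cbe n : continuous (be n) by exact: (svalP (cid (ext n))).1.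
have beE n (c : E_ n) (x : power X n) :
    be n (c, map_power (@stone_cech_unit R X) x) =
      stone_cech_unit R (e n (c, x)).
  exact: (svalP (cid (ext n))).2.
exists be; split=> //; first by split=> //; exact: stone_cech_tychonoff.
split=> //; first exact: stone_cech_unit_embedding.
move=> n c y ry.
have /choice[x xy] i : exists x, stone_cech_unit R x = y i.
  by have [x _ <-] := ry i; exists x.
exists (e n (c, x)) => //; rewrite -beE; congr (be n (c, _)).
exact/funext.
Qed.
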